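(* Let $c_0$ be the Banach space of real or complex valued null sequences with the supremum norm. Then $\mathcal{A}(c_0)=\mathcal{R}(c_0)=[1,\sigma]$, where $\sigma=3/2$ for real-valued sequences and $\sigma=\frac13+\frac{2\sqrt3}{\pi}$ for complex-valued sequences.
   Context: For a normed space $X$ with unit sphere $S_X$ (norm topology) and kernel $k(x,y)=\|x-y\|$: for a regular Borel probability measure $\mu$ concentrated on $S_X$, $U^\mu(x)=\int\|x-y\|\,d\mu(y)$ and $A(\mu):=[\inf_{S_X}U^\mu,\sup_{S_X}U^\mu]$. $\mathcal{A}(X)$ is the intersection of $A(\mu)$ over all regular Borel probability measures concentrated on $S_X$, and $\mathcal{R}(X)$ is the intersection of $A(\mu)$ over all $\mu=\frac1n\sum_{j=1}^n\delta_{w_j}$ with $n\in\mathbb{N}$, $w_j\in S_X$. *)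

(* Defs.v *)
From HB Require Import structures.
From mathcomp Require Import all_boot all_order all_algebra.
From mathcomp Require Import all_classical all_reals all_analysis.
From mathcomp Require complex.
Import complex.ComplexField.

Set Implicit Arguments.
Unset Strict Implicit.
Unset Printing Implicit Defensive.

Import Order.TTheory GRing.Theory Num.Theory.
Import numFieldNormedType.Exports.
Local Open Scope classical_set_scope.
Local Open Scope ring_scope.

(* The sequence space c_0(K) of null sequences with values in K, where
   nK : K -> R is the modulus on the scalars (absolute value for K = R,
   complex modulus for K = R[i]). *)
Section C0Space.
Variables (R : realType) (K : zmodType) (nK : K -> R) (nK0 : nK 0 = 0).

Definition is_null (x : nat -> K) : Prop := (fun n => nK (x n)) @ \oo --> (0 : R).

Record c0 := C0 { c0seq :> nat -> K; c0P : is_null c0seq }.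

HB.instance Definition _ := gen_eqMixin c0.
HB.instance Definition _ := gen_choiceMixin c0.

Lemma is_null0 : is_null (fun _ => 0).
Proof. by rewrite /is_null nK0; exact: cvg_cst. Qed.

HB.instance Definition _ := isPointed.Build c0 (C0 is_null0).

Definition c0dist (x y : c0) : R := sup (range (fun n => nK (x n - y n))).
Definition c0norm (x : c0) : R := sup (range (fun n => nK (x n))).

Definition c0sphere : set c0 := [set x | c0norm x = 1].

Definition c0open (U : set c0) : Prop :=
  forall x, U x -> exists e : R, 0 < e /\ forall y, c0dist x y < e -> U y.

Definition c0compact (C : set c0) : Prop :=
  forall F : set (set c0), F `<=` c0open -> C `<=` \bigcup_(U in F) U ->
  exists2 D : set (set c0), finite_set D /\ D `<=` F & C `<=` \bigcup_(U in D) U.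

Definition c0B := g_sigma_algebraType c0open.

Definition regular_measure (mu : probability c0B R) : Prop :=
  forall B : set c0B, measurable B ->
    (mu B = ereal_sup [set mu C | C in [set C : set c0B | c0compact C /\ C `<=` B]])%E /\
    (mu B = ereal_inf [set mu U | U in [set U : set c0B | c0open U /\ B `<=` U]])%E.

Definition concentrated_on_sphere (mu : probability c0B R) : Prop :=
  mu (~` c0sphere) = 0%E.

Definition potential (mu : probability c0B R) (x : c0) : \bar R :=
  (\int[mu]_y (c0dist x y)%:E)%E.

Definition Aint (mu : probability c0B R) : set R :=
  [set t : R | (ereal_inf [set potential mu x | x in c0sphere] <= t%:E)%E /\
               (t%:E <= ereal_sup [set potential mu x | x in c0sphere])%E].

Definition empirical_on_sphere (mu : probability c0B R) : Prop :=
  exists n : nat, exists w : 'I_n.+1 -> c0B,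
    (forall j, c0sphere (w j)) /\
    forall B : set c0B, measurable B ->
      mu B = ((n.+1%:R)^-1%:E * \sum_(j < n.+1) \d_(w j) B)%E.

Definition calA : set R :=
  [set t | forall mu : probability c0B R,
     regular_measure mu -> concentrated_on_sphere mu -> Aint mu t].

Definition calR : set R :=
  [set t | forall mu : probability c0B R, empirical_on_sphere mu -> Aint mu t].

End C0Space.

Definition calA_real (R : realType) := @calA R _ (@Num.norm R R) (@normr0 R R).
Definition calR_real (R : realType) := @calR R _ (@Num.norm R R) (@normr0 R R).
Definition calA_cplx (R : realType) := @calA R (complex.complex (R : rcfType)) (@complex.ComplexField.Normc.normc (R : rcfType)) (@complex.ComplexField.Normc.normc0 (R : rcfType)).
Definition calR_cplx (R : realType) := @calR R (complex.complex (R : rcfType)) (@complex.ComplexField.Normc.normc (R : rcfType)) (@complex.ComplexField.Normc.normc0 (R : rcfType)).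

(* Main.v *)
(** Lower end: for [y] in the sphere [|e_n - y| -> 1], so every potential has
    infimum at most 1, and [(delta_e + delta_-e)/2] has potential at least 1.
    Upper end: let [sigma] be the mean of [max(|u - y|, 1)] over unit scalars [u],
    for any [y] with [|y| = 1].  If [|y_k| = 1], the point [x = (u, .., u, 0, ..)]
    has [|x - y|] at least [|u - y_k|], and at least nearly 1 because of the late
    coordinates of the block; averaging over [u] gives a potential of supremum at
    least [sigma].  Conversely the uniform measure on the points [u e_0] has
    potential at most the mean of [max(|x_0 - u|, 1)], which is convex in [x_0] and
    hence at most [sigma].  Over the complex numbers the uniform distribution of
    [u] is replaced by the roots of unity of order [6m], with an error O(1/m). *)

From HB Require Import structures.
Require Import Defs.
From mathcomp Require Import all_boot all_order all_algebra.
From mathcomp Require Import all_classical all_reals all_analysis.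
From mathcomp Require Import measurable_realfun ring lra.
From mathcomp Require complex.
Import complex.ComplexField.

Set Implicit Arguments.
Unset Strict Implicit.
Unset Printing Implicit Defensive.

Import Order.TTheory GRing.Theory Num.Theory.
Import numFieldNormedType.Exports.
Local Open Scope classical_set_scope.
Local Open Scope ring_scope.

(** * The space c_0 and its potentials *)

Section NormedScalars.
Variables (R : realType) (K : zmodType) (nK : K -> R).
Hypothesis nK0 : nK 0 = 0.
Hypothesis nKD : forall x y, nK (x + y) <= nK x + nK y.
Hypothesis nKN : forall x, nK (- x) = nK x.

Local Notation c0K := (c0 (R := R) (K := K) nK).

Lemma nK_ge0 x : 0 <= nK x.
Proof. by have := nKD x (- x); rewrite subrr nK0 nKN -mulr2n pmulrn_lge0. Qed.

Lemma nK_dist_tri x y z : nK (x - z) <= nK (x - y) + nK (y - z).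
Proof. by have := nKD (x - y) (y - z); rewrite addrA subrK. Qed.

Lemma nKBC x y : nK (x - y) = nK (y - x).
Proof. by rewrite -nKN opprB. Qed.

Lemma null_eventually_lt (x : c0K) (e : R) : 0 < e ->
  exists N, forall n, (N <= n)%N -> nK (x n) < e.
Proof.
move=> e0; have /cvgrPdist_lt/(_ _ e0)[N _ HN] := c0P x.
exists N => n Nn; have := HN n Nn.
by rewrite /= sub0r normrN ger0_norm ?nK_ge0.
Qed.

Lemma null_bounded (x : c0K) : exists M, forall n, nK (x n) <= M.
Proof.
have [N HN] := null_eventually_lt x ltr01.
exists (1 + \sum_(i < N) nK (x i)) => n.
have [nN|Nn] := ltnP n N; last first.
  by apply: le_trans (ltW (HN _ Nn)) _; rewrite lerDl sumr_ge0// => i _; exact: nK_ge0.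
rewrite (bigD1 (Ordinal nN))//= addrCA lerDl addr_ge0// sumr_ge0// => i _.
exact: nK_ge0.
Qed.

Lemma le_c0dist (x y : c0K) n : nK (x n - y n) <= c0dist x y.
Proof.
apply: ub_le_sup; last by exists n.
have [[M HM] [M' HM']] := (null_bounded x, null_bounded y).
exists (M + M') => _ [k _ <-].
by apply: le_trans (nKD _ _) _; rewrite nKN lerD.
Qed.

Lemma c0dist_le (x y : c0K) M : (forall n, nK (x n - y n) <= M) -> c0dist x y <= M.
Proof.
move=> H; apply: ge_sup; first by exists (nK (x 0%N - y 0%N)); exists 0%N.
by move=> _ [k _ <-].
Qed.

Lemma c0dist_ge0 (x y : c0K) : 0 <= c0dist x y.
Proof. exact: le_trans (nK_ge0 _) (le_c0dist x y 0). Qed.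

Lemma c0distC (x y : c0K) : c0dist x y = c0dist y x.
Proof. by congr sup; apply: eq_imagel => n _; rewrite nKBC. Qed.

Lemma c0dist_tri (x y z : c0K) : c0dist x z <= c0dist x y + c0dist y z.
Proof.
apply: c0dist_le => n; apply: le_trans (nK_dist_tri _ (y n) _) _.
by rewrite lerD ?le_c0dist.
Qed.

Definition c00 : c0K := C0 (is_null0 nK0).

Lemma c0norm_dist0 (x : c0K) : c0norm x = c0dist x c00.
Proof. by congr sup; apply: eq_imagel => n _ /=; rewrite subr0. Qed.

Lemma le_c0norm (x : c0K) n : nK (x n) <= c0norm x.
Proof. by rewrite c0norm_dist0 -[x n]subr0; exact: (le_c0dist x c00). Qed.

Lemma c0norm_le (x : c0K) M : (forall n, nK (x n) <= M) -> c0norm x <= M.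
Proof. by rewrite c0norm_dist0 => H; apply: c0dist_le => n; rewrite subr0. Qed.

Lemma c0dist_sphere_le2 (x y : c0K) : c0sphere x -> c0sphere y -> c0dist x y <= 2.
Proof.
rewrite /c0sphere/= => x1 y1; apply: le_trans (c0dist_tri _ c00 _) _.
by rewrite (c0distC c00) -!c0norm_dist0 x1 y1.
Qed.

(** Otherwise all moduli are below 1. All but finitely many are below 1/2, and the finitely many
    others have a common bound below 1, so the supremum could not be 1. *)
Lemma sphere_attains (x : c0K) : c0sphere x -> exists k, nK (x k) = 1.
Proof.
rewrite /c0sphere/= => x1; apply: contrapT => /forallNP Hx.
have lt1 n : nK (x n) < 1 by rewrite lt_neqAle (introN eqP (Hx n))/= -x1 le_c0norm.
have [N HN] : exists N, forall n, (N <= n)%N -> nK (x n) < 2^-1.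
  by apply: null_eventually_lt; lra.
have [M M1 HM] : exists2 M, M < 1 & forall n, (n < N)%N -> nK (x n) <= M.
  elim: N {HN} => [|N [M M1 HM]]; first by exists 0.
  exists (Num.max M (nK (x N))); first by rewrite gt_max M1 lt1.
  move=> n; rewrite ltnS leq_eqVlt le_max => /orP[/eqP ->|/HM ->//].
  by rewrite lexx orbT.
have : c0norm x <= Num.max M 2^-1.
  apply: c0norm_le => n; rewrite le_max; have [/HM ->//|/HN/ltW ->] := ltnP n N.
  by rewrite orbT.
by rewrite x1 le_max => /orP[]; lra.
Qed.

Lemma is_null_block (u : K) (a b : nat) :
  is_null nK (fun k => if (a <= k < b)%N then u else 0).
Proof.
apply/cvgrPdist_lt => e e0; exists b => // n /= bn.
by rewrite ltnNge bn andbF nK0 subrr normr0.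
Qed.

Definition block u a b : c0K := C0 (is_null_block u a b).

Lemma block_sphere u a b : (a < b)%N -> nK u = 1 -> c0sphere (block u a b).
Proof.
move=> ab u1; rewrite /c0sphere/=; apply/eqP; rewrite eq_le; apply/andP; split.
  by apply: c0norm_le => n /=; case: ifP; rewrite ?u1 ?nK0.
by rewrite -u1; have := le_c0norm (block u a b) a; rewrite /= leqnn ab.
Qed.

(* The pointed structure of [c0] depends on the proof [nK0], which unification
   cannot guess; hence the explicit instances. *)
Definition c0pt := Defs_c0__canonical__classical_sets_Pointed nK0.
Definition c0M :=
  @measurable_structure_g_sigma_algebraType__canonical__measurable_structure_Measurable
    c0pt (c0open (nK:=nK)).

Lemma c0open_measurable (U : set c0M) : c0open U -> measurable U.
Proof. exact: sub_sigma_algebra. Qed.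

(** By the triangle inequality the sets of [y] with [c0dist x y > a] are open, and the rays above
    [a] generate the Borel sets of [R]. *)
Lemma measurable_c0dist (x : c0M) : measurable_fun [set: c0M] (c0dist x).
Proof.
apply: (measurability _ (RGenOInfty.measurableE R)) => // _ [_ [a ->] <-].
rewrite setTI; apply: c0open_measurable => y /=; rewrite in_itv/= andbT => ay.
exists (c0dist x y - a); split; first by rewrite subr_gt0.
move=> z yz; rewrite /= in_itv/= andbT.
have := c0dist_tri x z y; rewrite (c0distC z); lra.
Qed.

Lemma measurable_sphere : measurable (c0sphere (nK:=nK) : set c0M).
Proof.
have -> : c0sphere (nK:=nK) = [set: c0M] `&` (c0dist (c00 : c0M)) @^-1` [set 1].
  by rewrite setTI; apply/seteqP; split => y; rewrite /c0sphere/= c0norm_dist0 c0distC.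
exact: measurable_c0dist.
Qed.

Lemma measurable_Ec0dist (x : c0M) (D : set c0M) : measurable D ->
  measurable_fun D (fun y => (c0dist x y)%:E).
Proof.
by move=> mD; apply/measurable_EFinP; apply: measurable_funS (measurable_c0dist x).
Qed.

(** * Bounds on the potentials of a measure concentrated on the sphere *)

Section Concentrated.
Variable mu : probability c0M R.
Hypothesis muS : concentrated_on_sphere mu.

Local Notation S := (c0sphere (nK:=nK) : set c0M).
Local Open Scope ereal_scope.

Lemma potentialE (x : c0K) : potential mu x = \int[mu]_(y in S) (c0dist x y)%:E.
Proof.
rewrite /potential (ge0_negligible_integral (N := ~` S))//.
- by rewrite setTD setCK.
- by apply: measurableC; exact: measurable_sphere.
- exact: (measurable_Ec0dist x).
- by move=> y _; rewrite lee_fin c0dist_ge0.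
Qed.

Lemma sphere_mass1 : mu S = 1.
Proof.
have := probability_setC mu (measurableC measurable_sphere).
by rewrite setCK muS sube0.
Qed.

Lemma integral_sphere_cst (c : R) : \int[mu]_(x in S) (cst c%:E x) = c%:E.
Proof.
rewrite integral_cst; last exact: measurable_sphere.
by rewrite -[RHS]mule1; congr (_ * _); exact: sphere_mass1.
Qed.

Variable one : K.
Hypothesis one1 : nK one = 1%R.

(** Dominated convergence along the unit vectors [e n]: on the sphere the distances to [y] tend to 1
    and are at most 2, so the potentials at [e n] tend to 1. *)
Lemma ereal_inf_potential_le1 :
  ereal_inf [set potential mu x | x in c0sphere (nK:=nK)] <= 1.
Proof.
pose e n : c0M := block one n n.+1.
have eS n : c0sphere (e n) by apply: block_sphere.
have mS := measurable_sphere.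
have [] := @dominated_convergence _ c0M R mu S mS
  (fun n y => (c0dist (e n) y)%:E) (cst 1) (cst 2%:E).
- by move=> n; exact: measurable_Ec0dist.
- exact: measurable_cst.
- apply: aeW => y /= y1; apply: cvg_EFin; first exact: nearW.
  apply/cvgrPdist_lt => d d0.
  have [N HN] := null_eventually_lt y d0.
  have [k yk] := sphere_attains y1.
  exists (maxn N k.+1) => // n /=; rewrite geq_max => /andP[Nn kn].
  have := HN _ Nn => yn.
  (* Coordinate [n] alone gives the lower bound. In the upper bound every other coordinate
     contributes at most [c0norm y = 1]. *)
  have le1 : (1 - nK (y n) <= c0dist (e n) y)%R.
    apply: le_trans (le_c0dist _ _ n); rewrite /= leqnn ltnSn/=.
    by rewrite -one1 lerBlDr; have := nKD (one - y n) (y n); rewrite subrK.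
  have le2 : (c0dist (e n) y <= 1 + nK (y n))%R.
    apply: c0dist_le => i /=; rewrite ltnS -eqn_leq.
    case: eqP => [<-|_]; first by apply: le_trans (nKD _ _) _; rewrite one1 nKN.
    rewrite sub0r nKN; apply: ler_wpDr; first exact: nK_ge0.
    by rewrite -(y1 : c0norm y = 1%R) le_c0norm.
  by rewrite ltr_distlC; apply/andP; split; lra.
- apply/integrableP; split; first exact: measurable_cst.
  under eq_integral do rewrite /= ger0_norm//.
  by rewrite (integral_sphere_cst 2) ltry.
- apply: aeW => y /= n y1; rewrite lee_fin ger0_norm ?c0dist_ge0//.
  exact: c0dist_sphere_le2.
move=> _ _; rewrite integral_sphere_cst => cv.
rewrite -(cvg_lim _ cv)//; apply: lime_ge; first by apply/cvg_ex; exists 1.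
apply: nearW => n; apply: ereal_inf_lbound.
by exists (e n) => //; exact: potentialE.
Qed.

(* Fatou's lemma applied to the mean over [j] of the potentials of the points
   [(u_j, .., u_j, 0, 0, ..)]: an index [k] with [|y_k| = 1] contributes
   [|u_j - y_k|], and a late index contributes almost [1]. *)
Lemma ereal_sup_potential_ge (s : R) (n : nat) (u : 'I_n.+1 -> K) :
  (forall j, nK (u j) = 1%R) ->
  (forall y, nK y = 1%R ->
     s * n.+1%:R <= \sum_(j < n.+1) Num.max (nK (u j - y)) 1)%R ->
  s%:E <= ereal_sup [set potential mu x | x in c0sphere (nK:=nK)].
Proof.
move=> u1 us; apply/lee_addgt0Pr => d d0.
have mS := measurable_sphere.
pose f N (y : c0M) := (\sum_(j < n.+1) (c0dist (block (u j) 0 N.+1) y)%:E)%E.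
have mf N : measurable_fun S (f N).
  by apply: emeasurable_sum => j; exact: measurable_Ec0dist.
have f0 N y : 0 <= f N y by apply: sume_ge0 => j _; rewrite lee_fin c0dist_ge0.
set M := ereal_sup _.
(* If [s <= d], nonnegativity of a single potential suffices. Otherwise [s - d] is positive, so the
   constant below can be integrated as a nonnegative function. *)
have [sd|ds] := leP s d.
  apply: (@le_trans _ _ (0 + d%:E)); first by rewrite add0e lee_fin.
  rewrite leeD2r// /M; apply: ereal_sup_ge.
  exists (potential mu (block (u ord0) 0 1)); last first.
    by apply: integral_ge0 => y _; rewrite lee_fin c0dist_ge0.
  by exists (block (u ord0) 0 1) => //; exact: block_sphere.
have fM N : \int[mu]_(y in S) f N y <= n.+1%:R%:E * M.
  rewrite ge0_integral_sum//; [|by move=> j; exact: measurable_Ec0dist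
    |by move=> j y _; rewrite lee_fin c0dist_ge0].
  have -> : n.+1%:R%:E * M = \sum_(j < n.+1) M.
    by rewrite mule_natl big_const_ord iter_addr addr0.
  apply: lee_sum => j _; apply: ereal_sup_ubound.
  by exists (block (u j) 0 N.+1); [exact: block_sphere|exact: potentialE].
have := @fatou _ _ _ mu S mS f mf (fun N y _ => f0 N y).
have lo y : S y -> ((s - d) * n.+1%:R)%:E <= limn_einf (f^~ y).
  move=> y1; have [k yk] := sphere_attains y1.
  have [N HN] := null_eventually_lt y d0.
  rewrite limn_einf_lim; apply: lime_ge; first exact: is_cvg_einfs.
  exists (maxn N k) => // m /=; rewrite geq_max => /andP[Nm km].
  apply: le_ereal_inf_tmp => _ /= [p mp <-].
  rewrite /f sumEFin lee_fin.
  have := us _ yk.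
  have yp := HN _ (leq_trans Nm mp).
  suff : (\sum_(j < n.+1) Num.max (nK (u j - y k)) 1 <=
     \sum_(j < n.+1) (c0dist (block (u j) 0 p.+1) y + d))%R.
    rewrite big_split/= sumr_const card_ord -mulr_natr mulrBl; lra.
  apply: ler_sum => j _; rewrite ge_max; apply/andP; split.
    apply: ler_wpDr; first exact: ltW.
    have := le_c0dist (block (u j) 0 p.+1) y k.
    by rewrite /= ltnS (leq_trans km mp).
  have := le_c0dist (block (u j) 0 p.+1) y p.
  rewrite /= ltnS leqnn.
  have := nKD (u j - y p) (y p); rewrite subrK u1; lra.
move=> fat.
have : ((s - d) * n.+1%:R)%:E <= n.+1%:R%:E * M.
  apply: (@le_trans _ _ (\int[mu]_(y in S) limn_einf (f^~ y))).
    apply: (@le_trans _ _ (\int[mu]_(y in S) ((s - d) * n.+1%:R)%:E)).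
      by rewrite integral_sphere_cst.
    apply: ge0_le_integral => //.
    - by move=> x _; rewrite lee_fin mulr_ge0// subr_ge0 ltW.
    - apply: measurableT_comp => //.
      apply: measurable_fun_limn_esup => N; apply: measurableT_comp => //.
  apply: le_trans fat _; rewrite limn_einf_lim; apply: lime_le; first exact: is_cvg_einfs.
  by apply: nearW => m; apply: le_trans (fM m); apply: ereal_inf_lbound; exists m => /=.
rewrite EFinM muleC lee_pmul2l ?lte_fin ?ltr0n//.
by rewrite EFinB leeBlDr.
Qed.
End Concentrated.
End NormedScalars.

(** * Empirical measures *)

Section Empirical.
Context d (T : measurableType d) (R : realType).
Variables (n : nat) (w : 'I_n.+1 -> T).

Let invn_ge0 : 0 <= (n.+1%:R : R)^-1. Proof. by rewrite invr_ge0. Qed.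

(** Built from [mscale] and [msum] to inherit their measure structure; [msum] runs over natural
    numbers, hence [inord]. *)
Definition empirical : set T -> \bar R :=
  mscale (NngNum invn_ge0) (msum (fun i => \d_(w (inord i))) n.+1).

HB.instance Definition _ := Measure.on empirical.

Lemma empiricalE A :
  empirical A = ((n.+1%:R)^-1%:E * \sum_(j < n.+1) \d_(w j) A)%E.
Proof.
rewrite /empirical /mscale /msum/=; congr (_ * _)%E.
by apply: eq_bigr => i _; rewrite inord_val.
Qed.

Lemma empirical_setT : empirical setT = 1%E.
Proof.
rewrite empiricalE; under eq_bigr do rewrite diracT.
by rewrite sumEFin sumr_const card_ord -EFinM mulVf ?pnatr_eq0.
Qed.

HB.instance Definition _ := Measure_isProbability.Build _ _ _ empirical empirical_setT.

Lemma integral_empirical (f : T -> R) :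
  (forall x, 0 <= f x) -> measurable_fun setT f ->
  (\int[empirical]_x (f x)%:E)%E = ((\sum_(j < n.+1) f (w j)) / n.+1%:R)%:E.
Proof.
move=> f0 mf; have mEf : measurable_fun setT (EFin \o f) by exact/measurable_EFinP.
rewrite ge0_integral_mscale//=; last by move=> x _; rewrite lee_fin.
rewrite ge0_integral_measure_sum//=; last by move=> x _; rewrite lee_fin.
rewrite mulrC EFinM -sumEFin; congr (_ * _)%E; apply: eq_bigr => i _.
by rewrite inord_val integral_dirac// diracT mul1e.
Qed.
End Empirical.

Lemma le_empirical d (T : measurableType d) (R : realType) n (w : 'I_n.+1 -> T)
    (A B : set T) : (forall j, A (w j) -> B (w j)) ->
  (empirical R w A <= empirical R w B)%E.
Proof.
move=> AB; rewrite !empiricalE; apply: lee_wpmul2l.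
  by rewrite lee_fin invr_ge0 ler0n.
apply: lee_sum => j _; rewrite !diracE lee_fin ler_nat.
by have [/set_mem/AB/mem_set ->|] := boolP (w j \in A).
Qed.

(** * Regularity of empirical measures, and the two intervals from a family of unit scalars *)

Section Extremal.
Variables (R : realType) (K : zmodType) (nK : K -> R).
Hypothesis nK0 : nK 0 = 0.
Hypothesis nKD : forall x y, nK (x + y) <= nK x + nK y.
Hypothesis nKN : forall x, nK (- x) = nK x.
Hypothesis nK_eq0 : forall x, nK x = 0 -> x = 0.

Local Notation T := (c0M nK0).

Lemma c0dist_eq0 (x y : c0 nK) : c0dist x y = 0 -> x = y.
Proof.
move=> d0; have xy : c0seq x = c0seq y.
  apply: funext => n; apply/subr0_eq/nK_eq0/eqP.
  by rewrite eq_le nK_ge0// -{1}d0 le_c0dist.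
case: x y xy {d0} => x px [y py] /= xy; subst y.
by congr C0; exact: Prop_irrelevance.
Qed.

Lemma finite_c0compact (C : set (c0 nK)) : finite_set C -> c0compact C.
Proof.
move=> Cfin F _ CF.
have /choice[h hP] : forall c, exists U, C c -> F U /\ U c.
  move=> c; have [/CF[U FU Uc]|nC] := pselect (C c); first by exists U.
  by exists setT => /nC.
exists (h @` C); first split.
- exact: finite_image.
- by move=> _ [c /hP[]/= ? _ <-].
- by move=> c Cc; exists (h c); [exists c|exact: (hP c Cc).2].
Qed.

(** The atoms lying in [B] form a finite, hence compact, subset of full mass in [B]. The complement
    of the atoms outside [B] is an open superset of the same mass. *)
Lemma empirical_regular n (w : 'I_n.+1 -> T) :
  regular_measure (nK0 := nK0) (empirical R w).
Proof.
move=> B _; split.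
- apply/eqP; rewrite eq_le; apply/andP; split.
  + pose C : set (c0 nK) := B `&` range w.
    apply: (@le_trans _ _ (empirical R w C)).
      by apply: le_empirical => j Bj; split => //; exists j.
    apply: ereal_sup_ubound; exists C => //; split; last exact: subIsetl.
    apply: finite_c0compact; apply: finite_setIr; exact: finite_image.
  + by apply: ge_ereal_sup => _ [C [_ CB] <-]; apply: le_empirical => j /CB.
- apply/eqP; rewrite eq_le; apply/andP; split.
    by apply: le_ereal_inf_tmp => _ [U [_ BU] <-]; apply: le_empirical => j /BU.
  pose U : set (c0 nK) := [set x | forall j, ~ B (w j) -> x <> w j].
  apply: (@le_trans _ _ (empirical R w U)); last first.
    by apply: le_empirical => j Uj; apply: contrapT => /Uj.
  apply: ereal_inf_lbound; exists U => //; split; last first.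
    by move=> x Bx j nB xw; apply: nB; rewrite -xw.
  move=> x Ux.
  (* The least distance from [x] to an excluded atom; the default 1 keeps the radius positive when
     no atom is excluded. *)
  exists (\big[Num.min/1]_(j < n.+1 | `[<~ B (w j)>]) c0dist x (w j)).
  split.
    apply: lt_bigmin => // j /asboolP nB; rewrite lt_neqAle c0dist_ge0// andbT.
    by rewrite eq_sym; apply/eqP => /c0dist_eq0; exact: Ux.
  move=> y xy j nB yw; have : c0dist x y < c0dist x (w j).
    apply: lt_le_trans xy _; apply: bigmin_le_cond; exact/asboolP.
  by rewrite yw ltxx.
Qed.

Section OnSphere.
Variables (n : nat) (w : 'I_n.+1 -> T).
Hypothesis wS : forall j, c0sphere (w j : c0 nK).

Lemma empirical_concentrated : concentrated_on_sphere (nK0 := nK0) (empirical R w).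
Proof.
apply: eq_trans (empiricalE R w _) _; rewrite big1 ?mule0// => j _.
by rewrite diracE memNset//= => /(_ (wS j)).
Qed.

Lemma empirical_empirical_on_sphere :
  empirical_on_sphere (nK0 := nK0) (empirical R w).
Proof. by exists n, w; split => // B _; exact: empiricalE. Qed.

Lemma potential_empirical (x : c0 nK) :
  potential (nK0 := nK0) (empirical R w) x =
  ((\sum_(j < n.+1) c0dist x (w j)) / n.+1%:R)%:E.
Proof.
by apply: integral_empirical; [exact: c0dist_ge0|exact: measurable_c0dist].
Qed.

Lemma calA_Aint t : calA nK0 t -> Aint (nK0 := nK0) (empirical R w) t.
Proof. by apply; [exact: empirical_regular|exact: empirical_concentrated]. Qed.

Lemma calR_Aint t : calR nK0 t -> Aint (nK0 := nK0) (empirical R w) t.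
Proof. by apply; exact: empirical_empirical_on_sphere. Qed.

End OnSphere.

Lemma empirical_on_sphere_concentrated (mu : probability T R) :
  empirical_on_sphere mu -> concentrated_on_sphere mu.
Proof.
move=> [n [w [wS muE]]]; rewrite /concentrated_on_sphere muE; last first.
  by apply: measurableC; exact: measurable_sphere.
exact: eq_trans (esym (empiricalE R w _)) (empirical_concentrated wS).
Qed.

Variables (one : K) (sigma : R).
Hypothesis one1 : nK one = 1.
Hypothesis one2 : nK (one + one) = 2.
(* A finite family of unit scalars approximating the uniform distribution on
   the unit sphere of [K], whose mean of [max(|u - y|, 1)] is [sigma] at [|y| = 1]. *)
Hypothesis units : forall e, 0 < e -> exists n, exists u : 'I_n.+1 -> K,
  [/\ forall j, nK (u j) = 1,
      forall y, nK y <= 1 ->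
        \sum_(j < n.+1) Num.max (nK (u j - y)) 1 <= (sigma + e) * n.+1%:R &
      forall y, nK y = 1 ->
        (sigma - e) * n.+1%:R <= \sum_(j < n.+1) Num.max (nK (u j - y)) 1].

Lemma concentrated_Aint (mu : probability T R) t :
  concentrated_on_sphere mu -> 1 <= t <= sigma -> Aint mu t.
Proof.
move=> muS /andP[t1 ts]; split.
  apply: le_trans (ereal_inf_potential_le1 nKD nKN muS one1) _; by rewrite lee_fin.
apply: (@le_trans _ _ sigma%:E); first by rewrite lee_fin.
apply/lee_addgt0Pr => e e0; have [n [u [u1 _ us]]] := units e0.
by rewrite -leeBlDr// -EFinB; exact: (ereal_sup_potential_ge nKD nKN muS u1 us).
Qed.

Let ev (u : K) : c0 nK := block nK0 u 0 1.

Let evS u : nK u = 1 -> c0sphere (ev u).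
Proof. exact: block_sphere. Qed.

Lemma empirical_Aint_bounds t :
  (forall n (w : 'I_n.+1 -> T), (forall j, c0sphere (w j : c0 nK)) ->
     Aint (nK0 := nK0) (empirical R w) t) -> 1 <= t <= sigma.
Proof.
move=> H; apply/andP; split.
  (* For two antipodal points the distances from any [x] add up to at least [nK (one + one) = 2],
     already in coordinate 0. *)
  pose w (j : 'I_2) : T := ev (if j == 0 then one else - one).
  have [|+ _] := H _ w.
    by move=> j; apply: evS; case: ifP => _; rewrite ?nKN.
  rewrite -lee_fin; apply: le_trans.
  apply: le_ereal_inf_tmp => _ [x xS <-]; rewrite potential_empirical lee_fin.
  rewrite big_ord_recl big_ord1 ler_pdivlMr// mul1r.
  have := le_c0dist nK0 nKD nKN x (ev one) 0.
  have := le_c0dist nK0 nKD nKN x (ev (- one)) 0.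
  rewrite /=; have := nKD (x 0%N - - one) (- (x 0%N - one)).
  have -> : x 0%N - - one - (x 0%N - one) = one + one.
    by rewrite opprK opprB addrC addrA subrK.
  rewrite nKN one2.
  rewrite /w/=; lra.
apply/ler_addgt0Pr => e e0; have [n [u [u1 us _]]] := units e0.
have [|_] := H _ (fun j => ev (u j) : T); first by move=> j; exact: evS.
rewrite -lee_fin => /le_trans; apply.
apply: ge_ereal_sup => _ [x xS <-]; rewrite potential_empirical lee_fin.
rewrite ler_pdivrMr//.
have x1 k : nK (x k) <= 1 by rewrite -(xS : c0norm x = 1) le_c0norm.
(* Coordinate 0 of the difference has modulus [nK (u j - x 0)]; the others are coordinates of [x],
   of modulus at most 1. *)
apply: le_trans (us _ (x1 0%N)); apply: ler_sum => j _.
apply: c0dist_le => -[|k] /=; rewrite le_max.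
  by rewrite nKBC// lexx.
by rewrite subr0 x1 orbT.
Qed.

(** Empirical measures are admissible for both sets, which confines each to the interval; every
    admissible measure is concentrated on the sphere, which gives the converse. *)
Lemma calA_calR_interval :
  calA nK0 = [set t | 1 <= t <= sigma] /\ calR nK0 = [set t | 1 <= t <= sigma].
Proof.
split; apply/seteqP; split => t.
- by move=> tA; apply: empirical_Aint_bounds => n w wS; exact: calA_Aint.
- by move=> ts mu _ muS; exact: concentrated_Aint.
- by move=> tR; apply: empirical_Aint_bounds => n w wS; exact: calR_Aint.
- by move=> ts mu /empirical_on_sphere_concentrated muS; exact: concentrated_Aint.
Qed.

End Extremal.

(** * Real scalars *)

Lemma calA_calR_real (R : realType) :
  @calA_real R = [set t : R | 1 <= t <= 3 / 2] /\
  @calR_real R = [set t : R | 1 <= t <= 3 / 2].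
Proof.
apply: (@calA_calR_interval _ _ _ _ _ _ _ 1).
- exact: ler_normD.
- exact: normrN.
- by move=> x /normr0_eq0.
- exact: normr1.
- by rewrite ger0_norm//; lra.
(* For [|y| <= 1] the two terms [max(1 - y, 1)] and [max(1 + y, 1)] add up to [2 + |y|], which is at
   most 3, with equality when [|y| = 1]. *)
- move=> e e0; exists 1%N, (fun j => if j == 0 then 1 else -1); split.
  + by move=> j; case: ifP; rewrite ?normrN normr1.
  + move=> y y1; rewrite big_ord_recl big_ord1/=.
    have : -1 <= y <= 1 by rewrite -ler_norml.
    move=> /andP[y2 y3].
    rewrite ger0_norm ?subr_ge0// ler0_norm; last lra.
    by rewrite /Num.max; case: ifP; case: ifP; lra.
  + move=> y y1; rewrite big_ord_recl big_ord1/=.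
    have : y = 1 \/ y = -1.
      by have /eqP := y1; rewrite eqr_norml => /andP[/orP[]/eqP ->]; [left|right].
    case=> ->.
    * rewrite subrr normr0 -opprD normrN ger0_norm; last lra.
      by rewrite /Num.max; case: ifP; case: ifP; lra.
    * rewrite subrr normr0 opprK ger0_norm; last lra.
      by rewrite /Num.max; case: ifP; case: ifP; lra.
Qed.

(** * Trigonometric sums and roots of unity *)

Section Trigo.
Variable R : realType.
Implicit Types a b h x y : R.

Lemma sin_lipschitz x y : `|sin x - sin y| <= `|x - y|.
Proof.
wlog xy : x y / y <= x.
  by move=> W; have [/W//|/ltW/W] := leP y x; rewrite distrC (distrC y).
have [//|c _ ->] := @MVT_segment R sin cos y x xy.
  by apply: continuous_subspaceT => z; exact: continuous_sin.
rewrite normrM ler_piMl// ler_norml cos_geN1 cos_le1//.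
Qed.

Lemma normr_sin_le x : `|sin x| <= `|x|.
Proof. by have := sin_lipschitz x 0; rewrite sin0 !subr0. Qed.

(** The mean value theorem gives the increment as [h * sin c] with [c] within [h] of [a], and [sin]
    is 1-Lipschitz. *)
Lemma cos_increment a h : 0 <= h -> `|cos a - cos (a + h) - h * sin a| <= h ^+ 2.
Proof.
move=> h0; have ah : a <= a + h by rewrite lerDl.
have [|c cI cE] := @MVT_segment R cos (fun x => - sin x) a (a + h) ah.
  by apply: continuous_subspaceT => z; exact: continuous_cos.
have -> : cos a - cos (a + h) - h * sin a = h * (sin c - sin a).
  by rewrite -[cos a - _]opprB cE; ring.
rewrite normrM ger0_norm// expr2 ler_wpM2l//.
apply: le_trans (sin_lipschitz _ _) _; move: cI; rewrite in_itv/= => /andP[ac ch].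
by rewrite ger0_norm; lra.
Qed.

(** The cosine differences telescope, and each of the [n - m] steps costs an error of at most
    [h ^+ 2]. *)
Lemma sum_sin_increment m n h : 0 <= h -> (m <= n)%N ->
  `|cos (m%:R * h) - cos (n%:R * h) - h * \sum_(m <= j < n) sin (j%:R * h)|
    <= (n - m)%:R * h ^+ 2.
Proof.
move=> h0; elim: n => [|n IH].
  by rewrite leqn0 => /eqP ->; rewrite big_geq// mulr0 subr0 subrr normr0 mul0r.
rewrite leq_eqVlt => /orP[/eqP ->|].
  by rewrite big_geq// mulr0 subr0 subrr normr0 subnn mul0r.
rewrite ltnS => mn; have -> : n.+1%:R * h = n%:R * h + h.
  by rewrite -natr1 mulrDl mul1r.
rewrite big_nat_recr//= subSn// -natr1.
set s := \sum_(_ <= _ < _) _.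
have -> : cos (m%:R * h) - cos (n%:R * h + h) - h * (s + sin (n%:R * h)) =
   (cos (m%:R * h) - cos (n%:R * h) - h * s) +
   (cos (n%:R * h) - cos (n%:R * h + h) - h * sin (n%:R * h)) by ring.
apply: le_trans (ler_normD _ _) _; rewrite mulrDl mul1r lerD ?IH//.
exact: cos_increment.
Qed.

Lemma cos_pi6 : cos (pi / 6) = Num.sqrt 3 / 2 :> R.
Proof.
have p0 := pi_gt0 R.
have c0 : 0 < cos (pi / 6 : R) by apply: cos_gt0_pihalf; lra.
(* Triple angle: [4 c^3 - 3 c = 0] for [c = cos (pi / 6)], and [c > 0] leaves [c^2 = 3/4]. *)
have : cos (pi / 6 + (pi / 6 + pi / 6)) = 0 :> R.
  by rewrite -cos_pihalf; congr cos; field.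
rewrite !cosD !sinD => e.
have s2 := cos2Dsin2 (pi / 6 : R).
have c2 : cos (pi / 6) ^+ 2 = 3 / 4 :> R.
  have /eqP : cos (pi / 6) * (4 * cos (pi / 6) ^+ 2 - 3) = 0 :> R.
    by rewrite -e; have -> : (3 : R) = 3 * (cos (pi / 6) ^+ 2 + sin (pi / 6) ^+ 2);
      [rewrite s2 mulr1|ring].
  by rewrite mulf_eq0 gt_eqF//= => /eqP; lra.
apply/eqP; rewrite -(@eqrXn2 _ 2)// ?divr_ge0 ?sqrtr_ge0 ?ltW//.
by rewrite c2 exprMn sqr_sqrtr//; apply/eqP; field.
Qed.

Lemma sin_pi6 : sin (pi / 6) = 2^-1 :> R.
Proof.
have p0 := pi_gt0 R.
have s0 : 0 < sin (pi / 6 : R) by apply: sin_gt0_pihalf; lra.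
apply/eqP; rewrite -(@eqrXn2 _ 2)// ?invr_ge0 ?ltW// sin2cos2 cos_pi6.
by rewrite exprMn sqr_sqrtr//; apply/eqP; field.
Qed.

Lemma cos_5pi6 : cos (pi * 5 / 6) = - (Num.sqrt 3 / 2) :> R.
Proof.
by rewrite -cos_pi6 -(cosN (pi / 6)) -cosDpi; congr cos; field.
Qed.

Lemma sin_pi_sub x : sin (pi - x) = sin x.
Proof. by rewrite addrC sinDpi sinN opprK. Qed.

Lemma sin_le_half x : 0 <= x <= pi / 6 -> sin x <= 2^-1.
Proof.
move=> /andP[x0 x6]; have p0 := pi_gt0 R; rewrite -sin_pi6.
by rewrite leNgt ltr_sin ?in_itv/= -?leNgt; lra.
Qed.

Lemma sin_ge_half x : pi / 6 <= x <= pi * 5 / 6 -> 2^-1 <= sin x.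
Proof.
have p0 := pi_gt0 R.
wlog xp : x / x <= pi / 2.
  move=> W; have [/W//|xp /andP[x1 x2]] := leP x (pi / 2).
  by rewrite -sin_pi_sub; apply: W; lra.
move=> /andP[x6 _]; rewrite -sin_pi6.
by rewrite leNgt ltr_sin ?in_itv/= -?leNgt; lra.
Qed.

(* With [h = pi / 6m] the maximum is [1] for [j] outside [m, 5m); inside, the sum
   telescopes up to [O(h)] since [h sin(jh)] is close to [cos(jh) - cos((j+1)h)]. *)
Lemma sum_max_sin m : (0 < m)%N ->
  `|\sum_(0 <= j < 6 * m) Num.max (2 * sin (j%:R * (pi / (6 * m)%:R))) 1
     - (3^-1 + 2 * Num.sqrt 3 / pi) * (6 * m)%:R| <= pi * 4 / 3 :> R.
Proof.
move=> m0; have p0 := pi_gt0 R; set h := pi / _.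
have mR : 0 < m%:R :> R by rewrite ltr0n.
have h0 : 0 < h by rewrite divr_gt0// ltr0n muln_gt0.
have mh : m%:R * h = pi / 6.
  by rewrite /h natrM; field; rewrite gt_eqF.
have mh5 : (5 * m)%:R * h = pi * 5 / 6 by rewrite natrM -mulrA mh; field.
have mh6 : (6 * m)%:R * h = pi by rewrite natrM -mulrA mh; field.
have jle i j : (i <= j)%N -> i%:R * h <= j%:R * h.
  by move=> ij; rewrite ler_pM2r// ler_nat.
rewrite (@big_cat_nat _ _ _ m)//=; last by rewrite leq_pmull.
rewrite (@big_cat_nat _ _ _ (5 * m) m)//=; [|by rewrite leq_pmull|by rewrite leq_mul].
have -> : \sum_(0 <= j < m) Num.max (2 * sin (j%:R * h)) 1 = m%:R.
  rewrite (eq_big_nat _ _ (F2 := fun=> 1)) ?sumr_const_nat ?subn0//.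
  move=> j /andP[_ /ltnW/jle]; rewrite mh => jm; apply/max_idPr.
  have := @sin_le_half (j%:R * h); rewrite jm mulr_ge0 ?ler0n ?(ltW h0)//.
  by move=> /(_ isT); lra.
have -> : \sum_(5 * m <= j < 6 * m) Num.max (2 * sin (j%:R * h)) 1 = m%:R.
  rewrite (eq_big_nat _ _ (F2 := fun=> 1)) ?sumr_const_nat.
    by rewrite -mulnBl mul1n.
  move=> j /andP[/jle + /ltnW/jle]; rewrite mh5 mh6 => j1 j2; apply/max_idPr.
  have := @sin_le_half (pi - j%:R * h); rewrite sin_pi_sub.
  have -> : 0 <= pi - j%:R * h <= pi / 6 by lra.
  by move=> /(_ isT); lra.
have -> : \sum_(m <= j < 5 * m) Num.max (2 * sin (j%:R * h)) 1 =
    2 * \sum_(m <= j < 5 * m) sin (j%:R * h).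
  rewrite mulr_sumr; apply: eq_big_nat => j /andP[/jle + /ltnW/jle].
  rewrite mh mh5 => j1 j2; apply/max_idPl.
  have := @sin_ge_half (j%:R * h); rewrite j1 j2 => /(_ isT); lra.
have := @sum_sin_increment m (5 * m) h (ltW h0).
rewrite leq_pmull// => /(_ isT); rewrite mh mh5 cos_pi6 cos_5pi6.
set s := \sum_(_ <= _ < _) _.
have -> : (5 * m - m)%:R * h ^+ 2 = h * (pi * 4 / 6).
  have -> : pi * 4 / 6 = 4 * (m%:R * h) by rewrite mh; field.
  have -> : (5 * m - m = 4 * m)%N by rewrite -{2}(mul1n m) -mulnBl.
  by rewrite natrM; ring.
(* Cancelling [h] bounds the error of [s] by [pi * 4 / 6]; the factor 2 in front of [s] turns this
   into [pi * 4 / 3]. *)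
have -> : Num.sqrt 3 / 2 - - (Num.sqrt 3 / 2) - h * s = h * (Num.sqrt 3 / h - s).
  by field; rewrite gt_eqF.
rewrite normrM (gtr0_norm h0) ler_pM2l//.
have -> : Num.sqrt 3 / h = 6 * m%:R * Num.sqrt 3 / pi.
  by rewrite /h natrM invf_div mulrA [Num.sqrt 3 * _]mulrC.
have -> : m%:R + (2 * s + m%:R) - (3^-1 + 2 * Num.sqrt 3 / pi) * (6 * m)%:R =
   - 2 * (6 * m%:R * Num.sqrt 3 / pi - s).
  by rewrite natrM; lra.
by rewrite normrM normrN (ger0_norm (ler0n _ 2)); lra.
Qed.
End Trigo.

(** * Sums over the roots of unity in the complex plane *)

Section RootsOfUnity.
Variable R : realType.
Local Notation cplx := (complex.complex R).
Local Notation cmod := (@Normc.normc R).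
Implicit Types (a b t : R) (u y z : cplx).

Definition expi t : cplx := complex.Complex (cos t) (sin t).

Lemma mod_expi t : cmod (expi t) = 1.
Proof. by rewrite /= cos2Dsin2 sqrtr1. Qed.

Lemma expi0 : expi 0 = 1.
Proof. by rewrite /expi cos0 sin0. Qed.

Lemma expiD a b : expi (a + b) = expi a * expi b.
Proof. by rewrite /expi cosD sinD; congr complex.Complex; rewrite addrC mulrC. Qed.

(** Chord length: write the angles as [s + t] and [s - t]; the factor depending on the mean angle
    [s] has modulus 1. *)
Lemma mod_expiB a b : cmod (expi a - expi b) = 2 * `|sin ((a - b) / 2)|.
Proof.
set s := (a + b) / 2; set t := (a - b) / 2.
have -> : a = s + t by rewrite /s /t; field.
have -> : b = s - t by rewrite /s /t; field.
rewrite /= !cosD !sinD cosN sinN.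
rewrite [X in Num.sqrt X](_ : _ = (2 * sin t) ^+ 2); last first.
  have := cos2Dsin2 s; set c := cos s; set d := sin s; move=> cd.
  transitivity ((2 * sin t) ^+ 2 * (c ^+ 2 + d ^+ 2)); first by ring.
  by rewrite cd mulr1.
by rewrite sqrtr_sqr normrM ger0_norm.
Qed.

Lemma mod_expiB_le a b : cmod (expi a - expi b) <= `|a - b|.
Proof.
rewrite mod_expiB; have := normr_sin_le ((a - b) / 2).
by rewrite normrM [`|2^-1|]ger0_norm ?invr_ge0//; lra.
Qed.

Lemma unit_expi y : cmod y = 1 -> exists2 t, 0 <= t <= 2 * pi & y = expi t.
Proof.
have p0 := pi_gt0 R.
case: y => a b /= /(congr1 (fun x => x ^+ 2)).
rewrite expr1n sqr_sqrtr ?addr_ge0 ?sqr_ge0// => ab.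
have a1 : -1 <= a <= 1.
  rewrite -ler_norml -(@ler_pXn2r _ 2)// ?nnegrE// expr1n real_normK ?num_real//.
  by rewrite -ab lerDl sqr_ge0.
have sb : sin (acos a) = `|b|.
  by rewrite sin_acos// -ab addrAC subrr add0r sqrtr_sqr.
have [b0|b0] := leP 0 b.
  exists (acos a); first by have := acos_ge0 a1; have := acos_lepi a1; lra.
  by rewrite /expi acosK ?in_itv// sb ger0_norm.
(* [acos] covers the upper half circle only; the lower half is its reflection in the real axis. *)
exists (2 * pi - acos a).
  by have := acos_ge0 a1; have := acos_lepi a1; lra.
have -> : 2 * pi - acos a = - acos a + pi *+ 2 by rewrite -mulr_natl; ring.
by rewrite /expi cosD2pi sinD2pi cosN sinN acosK ?in_itv// sb ltr0_norm// opprK.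
Qed.

Definition root_sum n y : R :=
  \sum_(0 <= j < n) Num.max (cmod (expi (j%:R * (2 * pi / n%:R)) - y)) 1.

Lemma expi_period n : (0 < n)%N -> expi (n%:R * (2 * pi / n%:R)) = 1.
Proof.
move=> n0; rewrite mulrC divfK ?pnatr_eq0 -?lt0n//.
by rewrite mulr_natl /expi cos2pi sin2pi.
Qed.

(** Rotating [y] by one root shifts the summation index by one, and the term at [n] equals the term
    at 0. *)
Lemma root_sum_rot1 n y : (0 < n)%N ->
  root_sum n (expi (2 * pi / n%:R) * y) = root_sum n y.
Proof.
move=> n0; rewrite /root_sum; set d := 2 * pi / _.
pose G j := Num.max (cmod (expi (j%:R * d) - expi d * y)) 1.
have GS j : G j.+1 = Num.max (cmod (expi (j%:R * d) - y)) 1.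
  rewrite /G -natr1 mulrDl mul1r (addrC (j%:R * d)) expiD -mulrBr Normc.normcM.
  by rewrite mod_expi mul1r.
have Gn : G n = G 0%N by rewrite /G expi_period// mul0r expi0.
under [RHS]eq_bigr do rewrite -GS.
(* Both sides become the sum of [G] over the indices 0 to [n], split off at opposite ends. *)
apply: (addIr (G n)); rewrite -big_nat_recr// big_nat_recl// Gn; exact: addrC.
Qed.

Lemma root_sum_rot n k y : (0 < n)%N ->
  root_sum n (expi (k%:R * (2 * pi / n%:R)) * y) = root_sum n y.
Proof.
move=> n0; elim: k => [|k IH]; first by rewrite mul0r expi0 mul1r.
by rewrite -natr1 mulrDl mul1r addrC expiD -mulrA root_sum_rot1.
Qed.

Lemma modB_tri u y z : cmod (u - z) <= cmod (u - y) + cmod (y - z).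
Proof. by have := complex.le_normcD (u - y) (y - z); rewrite addrA subrK. Qed.

Lemma root_sum_lipschitz n y z : root_sum n y <= root_sum n z + n%:R * cmod (z - y).
Proof.
rewrite -{3}[n]subn0 mulr_natl -sumr_const_nat -big_split/=.
apply: ler_sum => j _; rewrite ge_max; apply/andP; split.
  by apply: le_trans (modB_tri _ z _) _; rewrite lerD2r le_max lexx.
apply: ler_wpDr; last by rewrite le_max lexx orbT.
by case: (z - y) => ? ? /=; exact: sqrtr_ge0.
Qed.

Lemma near_root n y : (0 < n)%N -> cmod y = 1 ->
  exists k, cmod (expi (k%:R * (2 * pi / n%:R)) - y) <= 2 * pi / n%:R.
Proof.
move=> n0 /unit_expi[t /andP[t0 _] ->]; have p0 := pi_gt0 R.
set d := 2 * pi / _; have d0 : 0 < d by rewrite divr_gt0 ?mulr_gt0 ?ltr0n.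
(* The last multiple of [d] not exceeding the angle [t]. *)
exists (Num.truncn (t / d)); apply: le_trans (mod_expiB_le _ _) _.
have /andP[] : (Num.truncn (t / d))%:R <= t / d < (Num.truncn (t / d)).+1%:R.
  by apply: truncn_itv; rewrite divr_ge0// ltW.
rewrite ler_pdivlMr// ltr_pdivrMr// -natr1 mulrDl mul1r => h1 h2.
by rewrite ler_norml; lra.
Qed.

(* [root_sum n] is invariant under rotation by the [n]-th roots of unity, which are
   [2 pi / n]-dense in the circle. *)
Lemma root_sum_near1 n y : (0 < n)%N -> cmod y = 1 ->
  `|root_sum n y - root_sum n 1| <= 2 * pi.
Proof.
move=> n0 y1; have [k kP] := near_root n0 y1.
have -> : root_sum n 1 = root_sum n (expi (k%:R * (2 * pi / n%:R))).
  by rewrite -(root_sum_rot k 1 n0) mulr1.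
set z := expi _ in kP *.
have nd : n%:R * cmod (z - y) <= 2 * pi.
  apply: le_trans (ler_wpM2l (ler0n _ _) kP) _.
  by rewrite mulrC divfK// pnatr_eq0 -lt0n.
have h1 := root_sum_lipschitz n y z.
have h2 := root_sum_lipschitz n z y.
have e : cmod (y - z) = cmod (z - y) by rewrite -[y - z]opprB complex.normcN.
by rewrite e in h2; rewrite ler_norml; lra.
Qed.

(** The mean of [max(2 sin x, 1)] over [x] in [[0, pi]], that is, of [max(|u - 1|, 1)] over the unit
    circle. *)
Definition sigmaC : R := 3^-1 + 2 * Num.sqrt 3 / pi.

Lemma root_sum1 m : (0 < m)%N ->
  `|root_sum (6 * m) 1 - sigmaC * (6 * m)%:R| <= pi * 4 / 3.
Proof.
move=> m0; apply: le_trans (sum_max_sin R m0); rewrite le_eqVlt; apply/orP; left.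
apply/eqP; congr (`|_ - _|); apply: eq_big_nat => j /andP[_ jm]; congr Num.max.
rewrite -expi0 mod_expiB subr0; congr (2 * _).
have p0 := pi_gt0 R.
have -> : j%:R * (2 * pi / (6 * m)%:R) / 2 = j%:R * (pi / (6 * m)%:R) :> R.
  by rewrite mulrAC -mulrA; congr (_ * _); field; rewrite pnatr_eq0 -lt0n.
rewrite ger0_norm//; apply: sin_ge0_pi.
have n0 : 0 < (6 * m)%:R :> R by rewrite ltr0n muln_gt0.
rewrite mulr_ge0 ?ler0n ?divr_ge0 ?(ltW p0) ?(ltW n0)//=.
by rewrite mulrA ler_pdivrMr// mulrC ler_pM2l// ler_nat ltnW.
Qed.

(** The errors [2 pi] (moving [y] to 1) and [4 pi / 3] (the sum at 1) add up to [10 pi / 3], below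
    16 since [pi < 4]. *)
Lemma root_sum_sphere m y : (0 < m)%N -> cmod y = 1 ->
  `|root_sum (6 * m) y - sigmaC * (6 * m)%:R| <= 16.
Proof.
move=> m0 y1; have n0 : (0 < 6 * m)%N by rewrite muln_gt0.
have := root_sum_near1 n0 y1; have := root_sum1 m0.
have := pihalf_lt2 R; rewrite !ler_norml; lra.
Qed.

Lemma modZ t y : 0 <= t -> cmod (complex.Complex t 0 * y) = t * cmod y.
Proof. by move=> t0; rewrite Normc.normcM /= expr0n addr0 sqrtr_sqr ger0_norm. Qed.

Lemma mod_polar y : exists2 z, cmod z = 1 & y = complex.Complex (cmod y) 0 * z.
Proof.
have [/Normc.eq0_normc ->|y0] := eqVneq (cmod y) 0.
  by exists 1; rewrite ?Normc.normc1// Normc.normc0 mul0r.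
have ym : 0 <= cmod y by case: (y) => ? ?; exact: sqrtr_ge0.
exists (complex.Complex (cmod y)^-1 0 * y).
  by rewrite modZ ?invr_ge0// mulVf.
case: y y0 ym => a b; set r := cmod _ => r0 _.
by congr complex.Complex; rewrite /=; field.
Qed.

(* [y] is a convex combination of the points [z], [- z] of the unit circle on the
   line through [y] and 0. *)
Lemma root_sum_convex n B y : cmod y <= 1 ->
  (forall z, cmod z = 1 -> root_sum n z <= B) -> root_sum n y <= B.
Proof.
move=> y1 HB; have [z z1 yE] := mod_polar y.
have ym : 0 <= cmod y by case: (y) => ? ?; exact: sqrtr_ge0.
set p := (1 + cmod y) / 2; set q := (1 - cmod y) / 2.
have p0 : 0 <= p by rewrite /p; lra.
have q0 : 0 <= q by rewrite /q; lra.
have pq : p + q = 1 by rewrite /p /q; lra.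
have nz1 : cmod (- z) = 1 by rewrite complex.normcN.
suff : root_sum n y <= p * root_sum n z + q * root_sum n (- z).
  move/le_trans; apply; rewrite -[leRHS]mul1r -pq mulrDl.
  by rewrite lerD// ler_wpM2l// HB.
rewrite /root_sum !mulr_sumr -big_split/=; apply: ler_sum => j _.
set u := expi _.
have -> : u - y = complex.Complex p 0 * (u - z) + complex.Complex q 0 * (u - - z).
  rewrite {1}yE /p /q; move: (cmod y) => r; clear.
  case: u z => [u1 u2] [z1 z2].
  by apply/eqP; rewrite complex.eq_complex/=; apply/andP; split; apply/eqP; field.
rewrite ge_max; apply/andP; split.
  apply: le_trans (complex.le_normcD _ _) _; rewrite !modZ//.
  by rewrite lerD// ler_wpM2l// le_max lexx.
by rewrite -[leLHS]pq; apply: lerD; rewrite ler_peMr// le_max lexx orbT.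
Qed.

Lemma complex_units e : 0 < e -> exists n, exists u : 'I_n.+1 -> cplx,
  [/\ forall j, cmod (u j) = 1,
      forall y, cmod y <= 1 ->
        \sum_(j < n.+1) Num.max (cmod (u j - y)) 1 <= (sigmaC + e) * n.+1%:R &
      forall y, cmod y = 1 ->
        (sigmaC - e) * n.+1%:R <= \sum_(j < n.+1) Num.max (cmod (u j - y)) 1].
Proof.
(* Chosen so that the total error 16, spread over [6 * m] roots, is at most [e] per root. *)
move=> e0; pose m := (Num.truncn (16 / e)).+1.
have m0 : (0 < m)%N by [].
have em : 16 <= e * (6 * m)%:R.
  have : 16 / e < m%:R by apply: truncnS_gt.
  rewrite ltr_pdivrMr// natrM; have : 0 < e * m%:R by rewrite mulr_gt0// ltr0n.
  lra.
have n0 : (6 * m).-1.+1 = (6 * m)%N by rewrite prednK// muln_gt0.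
have sumE y : \sum_(j < (6 * m).-1.+1)
    Num.max (cmod (expi (j%:R * (2 * pi / (6 * m)%:R)) - y)) 1 = root_sum (6 * m) y.
  rewrite -(big_mkord xpredT (fun j =>
    Num.max (cmod (expi (j%:R * (2 * pi / (6 * m)%:R)) - y)) 1)).
  by rewrite n0.
exists (6 * m).-1, (fun j => expi (j%:R * (2 * pi / (6 * m)%:R))); split.
- by move=> j; exact: mod_expi.
- move=> y y1; rewrite sumE n0; apply: root_sum_convex => // z z1.
  by have := root_sum_sphere m0 z1; rewrite ler_norml; lra.
- move=> y y1; rewrite sumE n0.
  by have := root_sum_sphere m0 y1; rewrite ler_norml; lra.
Qed.
End RootsOfUnity.

(** * Complex scalars, and the combined statement *)

Lemma calA_calR_cplx (R : realType) :
  @calA_cplx R = [set t : R | 1 <= t <= 3^-1 + 2 * Num.sqrt 3 / pi] /\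
  @calR_cplx R = [set t : R | 1 <= t <= 3^-1 + 2 * Num.sqrt 3 / pi].
Proof.
apply: (@calA_calR_interval _ _ _ _ _ _ _ (1 : complex.complex R)).
- exact: complex.le_normcD.
- exact: complex.normcN.
- exact: Normc.eq0_normc.
- exact: Normc.normc1.
- by rewrite /= addr0 expr0n addr0 sqrtr_sqr ger0_norm.
- exact: complex_units.
Qed.

Theorem theorem5p5 (R : realType) :
  @calA_real R = [set t : R | 1 <= t <= 3 / 2] /\
  @calR_real R = [set t : R | 1 <= t <= 3 / 2] /\
  @calA_cplx R = [set t : R | 1 <= t <= 3^-1 + 2 * Num.sqrt 3 / pi] /\
  @calR_cplx R = [set t : R | 1 <= t <= 3^-1 + 2 * Num.sqrt 3 / pi].
Proof.
have [? ?] := calA_calR_real R; have [? ?] := calA_calR_cplx R.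
by [].
Qed.
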